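(* Let $I=(E,\mathcal{I},c,T)$ be an EMB instance and let $P=(\mathrm{opt},\mathcal{F},\triangleleft)\in\mathcal{Q}$. Then: (1) if there is a solution $S$ for $R_P(I)$ with $v_I(S)=k_I\cdot H_I+T$, then $I$ is a yes-instance; (2) if $I$ is a yes-instance, then (i) $R_P(I)$ has a solution, and (ii) every $(1+\varepsilon_I)$-approximate solution $S$ for $R_P(I)$ satisfies $v_I(S)=k_I\cdot H_I+T$.
   Context: A matroid is a pair $(E,\mathcal{I})$ with $E$ finite, $\emptyset\in\mathcal{I}\subseteq2^E$, closed under subsets, with the exchange property; for $\mathcal{M}=(E,\mathcal{I})$, $\mathrm{IS}(\mathcal{M})=\mathcal{I}$, $\mathrm{bases}(\mathcal{M})$ is the set of independent sets of maximum cardinality. For a function $f$ on $E$ and $Y\subseteq E$, $f(Y)=\sum_{e\in Y}f(e)$. EMB instance: $(E,\mathcal{I},c,T)$ with $(E,\mathcal{I})$ a matroid, $c:E\to\mathbb{N}$, $T\in\mathbb{N}$; a solution is a basis $S$ with $c(S)=T$; it is a yes-instance iff a solution exists. $\mathcal{P}=\{\max,\min\}\times\{\mathrm{bases},\mathrm{IS}\}\times\{\le,\ge\}$, $\mathcal{Q}=\mathcal{P}\setminus\{(\min,\mathrm{IS},\le)\}$. For $P=(\mathrm{opt},\mathcal{F},\triangleleft)$, a $P$-MOL instance is $(E,\mathcal{I},v,w,L)$ with $(E,\mathcal{I})$ a matroid $\mathcal{M}$, $v,w:E\to\mathbb{R}_{\ge0}$, $L\in\mathbb{R}_{\ge0}$;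 a solution is $S\in\mathcal{F}(\mathcal{M})$ with $w(S)\triangleleft L$; the goal is to optimize ($\mathrm{opt}$) $v(S)$. A $\rho$-approximate solution ($\rho\ge1$) is a solution of value $\ge\mathrm{OPT}/\rho$ if $\mathrm{opt}=\max$, or $\le\rho\cdot\mathrm{OPT}$ if $\mathrm{opt}=\min$. Reduction: given EMB instance $I=(E,\mathcal{I},c,T)$ and $P\in\mathcal{Q}$, let $d(P)=0$ if ($\mathrm{opt}=\max$ and $\triangleleft$ is $\le$) or ($\mathrm{opt}=\min$ and $\triangleleft$ is $\ge$), and $d(P)=1$ otherwise; $H_I=2\max\{1,c(E)\}$; $v_I(e)=H_I+c(e)$; $w_{I,P}(e)=H_I+c(e)(-1)^{d(P)}$; $k_I=\max_{S\in\mathcal{I}}|S|$; $L_{I,P}=k_I H_I+T(-1)^{d(P)}$; and $R_P(I)=(E,\mathcal{I},v_I,w_{I,P},L_{I,P})$. Finally $\varepsilon_I=\frac{1}{8(|E|+1)(T+1)(c(E)+1)}$. *)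

(* Defs.v *)
From HB Require Import structures.
From mathcomp Require Import all_boot all_order all_algebra.
From mathcomp Require Import reals.

Set Implicit Arguments.
Unset Strict Implicit.
Unset Printing Implicit Defensive.

Import Order.TTheory GRing.Theory Num.Theory.
Local Open Scope ring_scope.

Record matroid (E : finType) := Matroid {
  IS : {set {set E}};
  IS_set0 : set0 \in IS;
  IS_subset : forall A B : {set E}, A \subset B -> B \in IS -> A \in IS;
  IS_exchange : forall A B : {set E}, A \in IS -> B \in IS ->
    (#|B| < #|A|)%N -> exists2 e, e \in A :\: B & e |: B \in IS
}.

Definition bases (E : finType) (M : matroid E) : {set {set E}} :=
  [set S in IS M | [forall S' in IS M, (#|S'| <= #|S|)%N]].

Record emb (E : finType) := Emb {
  emb_matroid : matroid E;
  emb_cost : E -> nat;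
  emb_target : nat
}.

Definition emb_solution (E : finType) (I : emb E) (S : {set E}) : Prop :=
  S \in bases (emb_matroid I) /\
  (\sum_(e in S) emb_cost I e)%N = emb_target I.

Definition emb_yes (E : finType) (I : emb E) : Prop :=
  exists S : {set E}, emb_solution I S.

Variant objective := Max | Min.
Variant family := Bases | Indep.
Variant comparison := Le | Ge.

Definition mol_param : Type := objective * family * comparison.

Definition in_Q (P : mol_param) : Prop := P <> (Min, Indep, Le).

(** The bound [mol_bound] carries no sign condition: the bound
    [k_I * H_I - T] of the reduction below is negative when [T] exceeds
    [k_I * H_I] (which only happens for no-instances), and the reduction is
    to be defined on every instance. *)
Record mol (R : realType) (E : finType) := Mol {
  mol_matroid : matroid E;
  mol_value : E -> R;
  mol_weight : E -> R;
  mol_bound : R;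
  mol_value_ge0 : forall e, 0 <= mol_value e;
  mol_weight_ge0 : forall e, 0 <= mol_weight e
}.

Definition feasible_family (E : finType) (F : family) (M : matroid E) :
    {set {set E}} :=
  match F with Bases => bases M | Indep => IS M end.

Definition compares (R : realType) (r : comparison) (x y : R) : Prop :=
  match r with Le => x <= y | Ge => x >= y end.

Definition mol_solution (R : realType) (E : finType) (P : mol_param)
    (X : mol R E) (S : {set E}) : Prop :=
  let: (_, F, r) := P in
  S \in feasible_family F (mol_matroid X) /\
  compares r (\sum_(e in S) mol_weight X e) (mol_bound X).

Definition is_OPT (R : realType) (E : finType) (P : mol_param)
    (X : mol R E) (x : R) : Prop :=
  (exists2 S : {set E}, mol_solution P X S & \sum_(e in S) mol_value X e = x) /\
  (forall S : {set E}, mol_solution P X S ->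
     match P.1.1 with
     | Max => \sum_(e in S) mol_value X e <= x
     | Min => x <= \sum_(e in S) mol_value X e
     end).

Definition approx_solution (R : realType) (E : finType) (P : mol_param)
    (rho : R) (X : mol R E) (S : {set E}) : Prop :=
  mol_solution P X S /\
  exists2 OPT : R, is_OPT P X OPT &
    match P.1.1 with
    | Max => \sum_(e in S) mol_value X e >= OPT / rho
    | Min => \sum_(e in S) mol_value X e <= rho * OPT
    end.

Definition red_d (P : mol_param) : nat :=
  match P with
  | (Max, _, Le) | (Min, _, Ge) => 0
  | _ => 1
  end.

Definition cost_total (E : finType) (I : emb E) : nat :=
  (\sum_(e : E) emb_cost I e)%N.

Definition red_H (E : finType) (I : emb E) : nat :=
  (2 * maxn 1 (cost_total I))%N.

Definition red_k (E : finType) (I : emb E) : nat :=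
  (\max_(S in IS (emb_matroid I)) #|S|)%N.

Definition red_v (R : realType) (E : finType) (I : emb E) (e : E) : R :=
  (red_H I)%:R + (emb_cost I e)%:R.

Definition red_w (R : realType) (E : finType) (P : mol_param) (I : emb E)
    (e : E) : R :=
  (red_H I)%:R + (emb_cost I e)%:R * (-1) ^+ red_d P.

Definition red_L (R : realType) (E : finType) (P : mol_param) (I : emb E) : R :=
  (red_k I)%:R * (red_H I)%:R + (emb_target I)%:R * (-1) ^+ red_d P.

Lemma red_v_ge0 (R : realType) (E : finType) (I : emb E) (e : E) :
  0 <= red_v R I e.
Proof. by rewrite addr_ge0. Qed.

Lemma red_w_ge0 (R : realType) (E : finType) (P : mol_param) (I : emb E)
    (e : E) : 0 <= red_w R P I e.
Proof.
have le_cH : (emb_cost I e <= red_H I)%N.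
  apply: (@leq_trans (cost_total I)).
    by rewrite /cost_total (bigD1 e) //= leq_addr.
  by rewrite /red_H mul2n -addnn (leq_trans (leq_maxr 1 _)) ?leq_addr.
rewrite /red_w; have: (red_d P <= 1)%N by case: P => [[[] ?] []].
case: (red_d P) => [|[|//]] _; first by rewrite expr0 mulr1 addr_ge0.
by rewrite expr1 mulrN1 subr_ge0 ler_nat.
Qed.

Definition reduction (R : realType) (E : finType) (P : mol_param)
    (I : emb E) : mol R E :=
  @Mol R E (emb_matroid I) (red_v R I) (red_w R P I) (red_L R P I)
    (@red_v_ge0 R E I) (@red_w_ge0 R E P I).

Definition red_eps (R : realType) (E : finType) (I : emb E) : R :=
  1 / (8 * (#|E|.+1)%:R * (emb_target I).+1%:R * (cost_total I).+1%:R).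

(* Main.v *)
Require Import Defs.
From mathcomp Require Import all_boot all_order all_algebra.
From mathcomp Require Import reals.
From mathcomp Require Import zify lra.

Import Order.TTheory GRing.Theory Num.Theory.
Local Open Scope ring_scope.

(** All costs together weigh less than [H_I], so a value
    [#|S| * H_I + c(S)] determines both [#|S|] and [c(S)]; this gives (1).
    For (2), a solution of the EMB instance attains the bound [L_{I,P}] exactly
    and has value [V = k_I * H_I + T], while in each case of [Q] the constraint
    forces every feasible value to lie on the non-improving side of [V].  Thus
    [V] is the optimum, and since values are integers and [V * eps_I < 1], an
    approximate solution cannot miss it. *)

Lemma leq_card_red_k {E : finType} {I : emb E} {S : {set E}} :
  S \in IS (emb_matroid I) -> (#|S| <= red_k I)%N.
Proof. by move=> SI; rewrite /red_k (bigD1 S) //= leq_maxl. Qed.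

Lemma in_bases_red_k (E : finType) (I : emb E) (S : {set E}) :
  (S \in bases (emb_matroid I))
  = (S \in IS (emb_matroid I)) && (#|S| == red_k I).
Proof.
rewrite inE; case SI: (S \in _) => //=; rewrite eqn_leq (leq_card_red_k SI) /=.
apply/forall_inP/idP => [maxS | le_kS S' S'I]; first exact/bigmax_leqP.
exact: leq_trans (leq_card_red_k S'I) le_kS.
Qed.

Lemma feasible_family_IS {E : finType} {F : Defs.family} {M : matroid E}
    {S : {set E}} : S \in feasible_family F M -> S \in IS M.
Proof. by case: F => //=; rewrite inE => /andP[]. Qed.

Lemma leq_cost_total {E : finType} (I : emb E) (S : {set E}) :
  (\sum_(e in S) emb_cost I e <= cost_total I)%N.
Proof. by rewrite /cost_total [X in (_ <= X)%N](bigID (mem S)) /= leq_addr. Qed.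

(** The factor 2 and the floor 1 in [red_H] make this strict, even when all costs are zero. *)
Lemma ltn_cost_red_H {E : finType} (I : emb E) (S : {set E}) :
  (\sum_(e in S) emb_cost I e < red_H I)%N.
Proof. by have := leq_cost_total I S; rewrite /red_H; lia. Qed.

(** Stated as one cast natural number, so that an error below one pins the value down. *)
Lemma sum_red_v (R : realType) (E : finType) (I : emb E) (S : {set E}) :
  \sum_(e in S) red_v R I e
  = (#|S| * red_H I + \sum_(e in S) emb_cost I e)%N%:R.
Proof.
by rewrite big_split /= sumr_const natrD natr_sum natrM [in RHS]mulr_natl.
Qed.

Lemma sum_red_w (R : realType) (E : finType) (P : mol_param) (I : emb E)
    (S : {set E}) :
  \sum_(e in S) red_w R P I e
  = #|S|%:R * (red_H I)%:R
    + (\sum_(e in S) emb_cost I e)%N%:R * (-1) ^+ red_d P.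
Proof.
by rewrite big_split /= sumr_const -mulr_suml natr_sum [in RHS]mulr_natl.
Qed.

(** The weight equals the bound, so either comparison holds, and a basis lies in both families. *)
Lemma emb_solution_mol_solution (R : realType) {E : finType} {I : emb E}
    (P : mol_param) {B : {set E}} :
  emb_solution I B -> mol_solution P (reduction R P I) B.
Proof.
case=> Bb cB; have := Bb; rewrite in_bases_red_k => /andP[BI /eqP cardB].
have wB : \sum_(e in B) red_w R P I e = red_L R P I.
  by rewrite sum_red_w cB cardB.
by case: P wB => [[o []] []] wB; split; rewrite //= wB.
Qed.

Lemma emb_yes_target_ltn {E : finType} {I : emb E} :
  emb_yes I -> (emb_target I < red_H I)%N.
Proof. by case=> B [_ <-]; apply: ltn_cost_red_H. Qed.

(** If [red_d P = 0], then [red_w] agrees with [red_v] and the constraint is the claim itself. If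
    [red_d P = 1], the size of [S] must be [red_k I], and the negated cost then reverses the
    inequality. *)
Lemma solution_value_bound {R : realType} {E : finType} {I : emb E}
    {P : mol_param} {S : {set E}} :
  in_Q P -> emb_yes I -> mol_solution P (reduction R P I) S ->
  let x := (#|S| * red_H I + \sum_(e in S) emb_cost I e)%N in
  let V := (red_k I * red_H I + emb_target I)%N in
  match P.1.1 with Max => (x <= V)%N | Min => (V <= x)%N end.
Proof.
case: P => [[o F] r] hP /emb_yes_target_ltn ltTH [SF] /=.
have := leq_card_red_k (feasible_family_IS SF).
rewrite sum_red_w /red_L.
move: SF; set s := #|S|; set c := (\sum_(e in S) _)%N => SF le_sk.
case: o r hP SF => [] [] /= hP SF.
- by rewrite expr0 !mulr1 -!natrM -!natrD ler_nat.
- rewrite expr1 !mulrN1 lerBrDr addrAC lerBlDr -!natrM -!natrD ler_nat.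
  (* A smaller [S] would weigh at most [(k - 1) * H < k * H - T]. *)
  have [lt_sk|] := ltnP s (red_k I); last by nia.
  by have := leq_mul lt_sk (leqnn (red_H I)); rewrite mulSn; lia.
(* The only case that uses [in_Q]: [Le] gives no lower bound on the size, so the size must come from
   [Bases]. *)
- case: F SF hP => /= SF hP; last by case: hP.
  move: SF; rewrite in_bases_red_k => /andP[_ /eqP eq_sk].
  rewrite /s eq_sk expr1 !mulrN1 lerD2l lerN2 ler_nat; lia.
- by rewrite expr0 !mulr1 -!natrM -!natrD ler_nat.
Qed.

Lemma red_eps_gt0 (R : realType) {E : finType} (I : emb E) :
  0 < red_eps R I.
Proof. by rewrite /red_eps divr_gt0 // !mulr_gt0 // ltr0n. Qed.

(** Since [red_k I <= #|E|] and [red_H I <= 2 * (cost_total I).+1], the value stays below the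
    denominator of [red_eps]. *)
Lemma optimum_mul_eps_lt1 (R : realType) {E : finType} (I : emb E) :
  (red_k I * red_H I + emb_target I)%N%:R * red_eps R I < 1.
Proof.
rewrite /red_eps mulrA mulr1 ltr_pdivrMr; last by rewrite !mulr_gt0 // ltr0n.
rewrite mul1r -!natrM ltr_nat.
have le_kE : (red_k I <= #|E|)%N by apply/bigmax_leqP => A _; apply: max_card.
have le_H : (red_H I <= 2 * (cost_total I).+1)%N by rewrite /red_H; lia.
have := leq_mul le_kE le_H.
move: (red_k I * red_H I)%N (emb_target I) (cost_total I) #|E| => x T c n le_x.
suff: (2 * n * c.+1 + T < 8 * n.+1 * T.+1 * c.+1)%N by lia.
nia.
Qed.

Theorem theorem3p2 (R : realType) (E : finType) (I : emb E) (P : mol_param)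
    (hP : in_Q P) :
  ((exists2 S : {set E}, mol_solution P (reduction R P I) S &
      \sum_(e in S) red_v R I e
        = (red_k I)%:R * (red_H I)%:R + (emb_target I)%:R) ->
   emb_yes I) /\
  (emb_yes I ->
   (exists S : {set E}, mol_solution P (reduction R P I) S) /\
   (forall S : {set E},
      approx_solution P (1 + red_eps R I) (reduction R P I) S ->
      \sum_(e in S) red_v R I e
        = (red_k I)%:R * (red_H I)%:R + (emb_target I)%:R)).
Proof.
rewrite -natrM -natrD; split=> [[S solS] | yesI].
  have SI : S \in IS (emb_matroid I).
    by case: P hP solS => [[o F] r] _ [/feasible_family_IS].
  rewrite sum_red_v => /eqP; rewrite eqr_nat => /eqP eqV.
  have le_sk := leq_card_red_k SI; have lt_cH := ltn_cost_red_H I S.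
  have eq_sk : #|S| = red_k I.
    (* A smaller [S] would have value below [(#|S| + 1) * H <= k * H], against [eqV]. *)
    apply/eqP; rewrite eqn_leq le_sk leqNgt; apply/negP => lt_sk.
    by have := leq_mul lt_sk (leqnn (red_H I)); rewrite mulSn; lia.
  exists S; split; first by rewrite in_bases_red_k SI eq_sk eqxx.
  by move: eqV; rewrite eq_sk => /addnI.
have [B solB] := yesI; have molB := emb_solution_mol_solution R P solB.
split=> [|S [solS [x [_ optx]]]]; first by exists B.
have := optx _ molB; have := solution_value_bound hP yesI solS => /=.
have vB : \sum_(e in B) red_v R I e
          = (red_k I * red_H I + emb_target I)%N%:R.
  case: solB => Bb cB; rewrite sum_red_v cB.
  by move: Bb; rewrite in_bases_red_k => /andP[_ /eqP ->].
rewrite vB sum_red_v.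
have := optimum_mul_eps_lt1 R I; have := red_eps_gt0 R I.
move: (red_eps R I) (_ + _)%N (_ + _)%N => eps y V eps0 Veps.
case: P.1.1 => le_yV le_optV le_approx; congr _%:R; apply/eqP.
(* With [x] the optimum, [y] the value of [S] and [V] the target value:
   [V <= x <= y + y * eps < y + 1], as [y <= V]. *)
- rewrite eqn_leq le_yV -ltnS -(ltr_nat R) -natr1 /=.
  have le1 : x <= y%:R * (1 + eps) by rewrite -ler_pdivrMr; lra.
  have : y%:R * eps <= V%:R * eps by rewrite ler_pM2r // ler_nat.
  lra.
(* Dually, [y <= (1 + eps) * x <= V + V * eps < V + 1]. *)
- rewrite eqn_leq le_yV andbT -ltnS -(ltr_nat R) -natr1.
  have : (1 + eps) * x <= (1 + eps) * V%:R by rewrite ler_pM2l //; lra.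
  lra.
Qed.
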